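(* Let $\Lambda$ be a countably infinite set and let $\Gamma$ be a subshift of $\Lambda^\omega$. If $\Gamma$ is a subshift of finite type, then there exists $x\in\Gamma$ with $\omega(x)=\Gamma$.
   Context: Let $\omega=\{0,1,2,\dots\}$. $\Lambda^\omega$ is the set of infinite sequences $x=x_0x_1x_2\cdots$ over $\Lambda$, with the product topology where $\Lambda$ is discrete; the shift map is $\sigma(x_0x_1x_2\cdots)=x_1x_2\cdots$. A subshift of $\Lambda^\omega$ is a closed set $\Gamma\subseteq\Lambda^\omega$ with $\sigma(\Gamma)=\Gamma$. A word is a finite sequence over $\Lambda$ of length at least $1$; it is allowed for $\Gamma$ if it occurs as a block of consecutive symbols (subword) of some $x\in\Gamma$, and forbidden otherwise. A basis for the forbidden words of $\Gamma$ is a set $\mathcal F$ of forbidden words such that every forbidden word contains some element of $\mathcal F$ as a subword. $\Gamma$ is a subshift of finite type (SFT) if it has a finite basis for its forbidden words. For a point $x$, $\omega(x)=\bigcap_{N\in\omega}\overline{\{\sigma^i(x):i\ge N\}}$. *)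

(* Defs.v *)
From mathcomp Require Import all_boot.
From mathcomp Require Import all_classical topology function_spaces.

Set Implicit Arguments.
Unset Strict Implicit.
Unset Printing Implicit Defensive.

Local Open Scope classical_set_scope.
Local Open Scope card_scope.

Notation "L ^omega" := {ptws nat -> discrete_topology L}
  (at level 2, format "L ^omega") : type_scope.

Section Subshifts.
Context {L : choiceType}.
Implicit Types (x : L^omega) (G : set L^omega) (w : seq L).

Definition shift x : L^omega := fun n => x n.+1.

Definition subshift G := closed G /\ shift @` G = G.

Definition word w : Prop := (0 < size w)%N.

Definition occurs_in w x := exists i, w = mkseq (fun j => x (i + j)%N) (size w).

Definition allowed G w := word w /\ exists2 x, G x & occurs_in w x.

(* The first conjunct keeps [::], which is not a word, from counting as
   forbidden: it would occur in every word and be a basis by itself. *)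
Definition forbidden G w := word w /\ ~ allowed G w.

Definition forbidden_basis G (F : set (seq L)) :=
  F `<=` forbidden G /\
  forall w, forbidden G w -> exists2 v, F v & infix v w.

Definition finite_type G := exists2 F, finite_set F & forbidden_basis G F.

Definition omega_limit x : set L^omega :=
  \bigcap_(N in [set: nat])
    closure [set iter i shift x | i in [set i | (N <= i)%N]].

End Subshifts.

(* Main.v *)
Require Import Defs.
From mathcomp Require Import all_boot.
From mathcomp Require Import all_classical topology function_spaces.

Local Open Scope classical_set_scope.
Local Open Scope card_scope.

(** A finite basis of forbidden words uses only finitely many letters, so some
    letter [a] occurs in none of them. A word [u ++ a :: v] then contains a
    basis word only if [u] or [v] does, so any list of allowed words can be
    glued together with [a] as separator. Gluing an enumeration of all allowed
    words gives a point of the subshift whose orbit visits every cylinder. The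
    visits are arbitrarily late because [a ... a w] is allowed together with
    [w]. *)

Lemma prefix_cat_cons (T : eqType) (a : T) (f u v : seq T) :
  a \notin f -> prefix f (u ++ a :: v) = prefix f u.
Proof.
elim: f u => [|b f IHf] [|c u] //=; rewrite inE negb_or => /andP[nab nf].
  by rewrite eq_sym (negPf nab).
by rewrite IHf.
Qed.

Lemma infix_cat_cons (T : eqType) (a : T) (f u v : seq T) :
  a \notin f -> infix f (u ++ a :: v) = infix f u || infix f v.
Proof.
move=> nf; elim: u => [|c u IHu].
  rewrite infix_consl infixs0.
  by rewrite -[a :: v]cat0s (prefix_cat_cons _ _ _ [::]) // prefixs0.
by rewrite cat_cons !infix_consl IHu -cat_cons prefix_cat_cons // orbA.
Qed.

Definition avoids {T : eqType} (fs : seq (seq T)) (w : seq T) :=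
  all (fun f => ~~ infix f w) fs.

Section Avoidance.
Variables (T : eqType) (fs : seq (seq T)).

Lemma avoids_infix v w : infix v w -> avoids fs w -> avoids fs v.
Proof.
move=> vw /allP avw; apply/allP => f /avw; apply: contra => fv.
exact: infix_trans fv vw.
Qed.

Lemma avoids_cat_cons a u v : {in fs, forall f, a \notin f} ->
  avoids fs (u ++ a :: v) = avoids fs u && avoids fs v.
Proof.
move=> nafs; rewrite /avoids -all_predI; apply: eq_in_all => f ffs /=.
by rewrite infix_cat_cons ?nafs // negb_or.
Qed.

Lemma avoids_nseq_cat a n v : {in fs, forall f, a \notin f} ->
  avoids fs [::] -> avoids fs v -> avoids fs (nseq n a ++ v).
Proof.
move=> nafs av0 avv; elim: n => [//|n IHn].
by rewrite -[_ ++ _]/([::] ++ a :: (nseq n a ++ v)) avoids_cat_cons // av0.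
Qed.

End Avoidance.

Lemma prefix_chain_limit (T : eqType) (a : T) (P : nat -> seq T) :
    (forall n, prefix (P n) (P n.+1)) -> (forall n, n <= size (P n))%N ->
  exists x, forall n, mkseq x (size (P n)) = P n.
Proof.
move=> Pchain Psize; have Pmono m n : (m <= n)%N -> prefix (P m) (P n).
  move=> /subnK<-; elim: (n - m)%N => [|k IHk]; first exact: prefix_refl.
  exact: prefix_trans IHk (Pchain _).
have Pnth m n i : (m <= n)%N -> (i < size (P m))%N ->
    nth a (P n) i = nth a (P m) i.
  by move=> /Pmono/prefixP[s ->] ltis; rewrite nth_cat ltis.
exists (fun i => nth a (P i.+1) i) => n.
apply: (@eq_from_nth _ a); rewrite size_mkseq // => i ltin.
rewrite nth_mkseq //; case/orP: (leq_total n i.+1) => [le_n|le_i].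
  exact: Pnth.
by rewrite (Pnth _ _ _ le_i).
Qed.

Lemma countable_surj_seq (T : choiceType) : countable [set: T] ->
  exists e : nat -> seq T, forall w, exists n, e n = w.
Proof.
case/countable_injP => f f_inj.
have injF : injective (fun w : seq T => pickle (map f w)).
  move=> u v /(pcan_inj (@pickleK (seq nat))); apply: inj_map u v => t u.
  by apply: f_inj; rewrite inE.
exists (fun n => xget [::] [set w | pickle (map f w) = n]) => w.
by exists (pickle (map f w)); case: xgetP => [v _ /injF //|/(_ w)[]].
Qed.

Lemma infinite_fresh (T : choiceType) (fs : seq (seq T)) :
  infinite_set [set: T] -> exists a, {in fs, forall f, a \notin f}.
Proof.
move=> infT; have /infinite_setN0[a [_ /= /negP na]] :
    infinite_set ([set: T] `\` [set` flatten fs]).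
  by apply: infinite_setD => //; exact: finite_seq.
by exists a => f ffs; apply: contra na => af; apply/flattenP; exists f.
Qed.

Section Subshifts.
Context {L : choiceType}.
Implicit Types (x y : L^omega) (G : set L^omega).

Lemma closure_mkseqP G y :
  closure G y <-> forall n, exists2 z, G z & mkseq z n = mkseq y n.
Proof.
split=> [Gy n|Gy].
  have ny : nbhs y [set z : L^omega | mkseq z n = mkseq y n].
    elim: n => [|n IHn]; first by apply: filterS filterT => z _.
    have : nbhs y (proj n @^-1` [set y n]).
      exact: (@proj_continuous nat (fun=> discrete_topology L) n y
                _ (discrete_set1 (y n))).
    by apply: filterS2 IHn => z /= ezn znE; rewrite !mkseqS ezn -znE.
  by have [z [Gz zn]] := Gy _ ny; exists z.
have [u Gu uE] : exists2 u : nat -> L^omega,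
    (forall n, G (u n)) & forall n, mkseq (u n) n = mkseq y n.
  have [u uP] := choice (fun n => let: ex_intro2 z Gz zE := Gy n in
    ex_intro (fun z => G z /\ mkseq z n = mkseq y n) z (conj Gz zE)).
  by exists u => n; have [] := uP n.
suff uy : u @ \oo --> y.
  apply: (closed_cvg _ (@closed_closure _ G) _ _ uy).
  by apply: nearW => n; apply: subset_closure.
apply/pointwise_cvgP => i.
apply/discrete_cvg; exists i.+1 => // n /= lt_in.
by have := congr1 (fun s => nth (y i) s i) (uE n); rewrite !nth_mkseq.
Qed.

Lemma iter_shiftE i x : iter i shift x = fun j => x (i + j)%N.
Proof.
elim: i => [|i IHi]; first by apply/funext.
by rewrite iterS IHi; apply/funext => j; rewrite /shift addnS.
Qed.

Lemma subshift_iter G i x : subshift G -> G x -> G (iter i shift x).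
Proof.
case=> _ sG Gx; elim: i => [//|i IHi].
by rewrite iterS -sG; exists (iter i shift x).
Qed.

Lemma allowed_mkseq G w : subshift G -> allowed G w ->
  exists2 y, G y & mkseq y (size w) = w.
Proof.
move=> sG [_ [x Gx [i ->]]]; exists (iter i shift x).
  exact: subshift_iter.
by rewrite size_mkseq iter_shiftE.
Qed.

Lemma mkseq_allowed G y n : G y -> allowed G (mkseq y n.+1).
Proof.
move=> Gy; split; first by rewrite /word size_mkseq.
by exists y => //; exists 0; rewrite size_mkseq.
Qed.

Lemma infix_allowed G v w : word v -> infix v w -> allowed G w -> allowed G v.
Proof.
move=> wv /infixP[p [s ->]] [_ [x Gx [i xE]]]; split=> //; exists x => //.
exists (i + size p); case: v wv xE => // b v _ xE.
apply: (@eq_from_nth _ b) => [|j lt_j]; first by rewrite size_mkseq.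
have := congr1 (fun t => nth b t (size p + j)) xE.
rewrite nth_mkseq; last by rewrite !size_cat ltn_add2l ltn_addr.
rewrite !nth_cat ltnNge leq_addr /= addKn lt_j addnA => ->.
by rewrite nth_mkseq.
Qed.

Lemma finite_type_avoids G : finite_type G ->
  exists fs, avoids fs [::] /\ forall w, word w -> allowed G w <-> avoids fs w.
Proof.
case=> F /finite_seqP[fs ->] [fsP basis]; exists fs; split.
  by apply/allP => f /fsP[wf _]; rewrite infixs0 -size_eq0 -lt0n.
move=> w ww; split=> [Gw|/allP aw].
  apply/allP => f /fsP[wf nGf]; apply/negP => fw; apply: nGf.
  exact: infix_allowed fw Gw.
apply: contrapT => nGw; have [f ffs fw] := basis w (conj ww nGw).
by have := aw f ffs; rewrite fw.
Qed.

End Subshifts.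

Theorem corollary19 (Lambda : choiceType) (Gamma : set Lambda^omega) :
  [set: Lambda] #= [set: nat] ->
  subshift Gamma ->
  finite_type Gamma ->
  exists2 x, Gamma x & omega_limit x = Gamma.
Proof.
move=> cardL sG /finite_type_avoids[fs [av0 avP]].
have [a afs] : exists a, {in fs, forall f, a \notin f}.
  by apply: infinite_fresh; apply/infiniteP; have /card_eqPle[] := cardL.
have [e e_surj] : exists e : nat -> seq Lambda, forall w, exists n, e n = w.
  by apply: countable_surj_seq; rewrite (eq_countable cardL).
pose fix P n := if n is m.+1
  then P m ++ a :: (if avoids fs (e m) then e m else [::]) else [::].
have avoidsP n : avoids fs (P n).
  by elim: n => //= n IHn; rewrite avoids_cat_cons // IHn; case: ifP.
have Psize n : (n <= size (P n))%N.
  elim: n => //= n IHn.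
  by rewrite size_cat /= addnS ltnS (leq_trans IHn) ?leq_addr.
have [x xP] := @prefix_chain_limit _ a P (fun n => prefix_prefix _ _) Psize.
have closedG : closure Gamma = Gamma by have [/closure_id] := sG.
have Gx : Gamma x.
  rewrite -closedG; apply/closure_mkseqP => n.
  have wP : word (P n.+1) by rewrite /word (leq_trans _ (Psize _)).
  have [y Gy yE] := allowed_mkseq _ _ sG ((avP _ wP).2 (avoidsP n.+1)).
  exists y => //.
  have := congr1 (take n) (etrans yE (esym (xP n.+1))); rewrite /mkseq.
  by rewrite -!map_take !take_iota (minn_idPl (ltnW (Psize n.+1))).
exists x => //; apply/seteqP; split=> [z /(_ 0 I)|y Gy N _].
  rewrite -[in Gamma z]closedG; apply: closureS => _ [i _ <-].
  exact: subshift_iter.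
apply/closure_mkseqP => n.
pose w := nseq N a ++ mkseq y n.+1.
have avw : avoids fs w.
  apply: avoids_nseq_cat => //; apply/avP; first by rewrite /word size_mkseq.
  exact: mkseq_allowed.
have [m emw] := e_surj w.
have PSm : P m.+1 = (P m ++ a :: nseq N a) ++ mkseq y n.+1.
  by rewrite /= emw avw -catA.
pose i := size (P m ++ a :: nseq N a).
exists (iter i shift x).
  exists i => //=; rewrite /i size_cat /= size_nseq addnS -addSn.
  exact: leq_addl.
rewrite iter_shiftE.
apply: (@eq_from_nth _ a); rewrite !size_mkseq // => j ltjn.
rewrite !nth_mkseq //.
have := congr1 (fun s => nth a s (i + j)) (xP m.+1); rewrite nth_mkseq.
  move=> ->; rewrite PSm nth_cat ltnNge leq_addr /= addKn nth_mkseq //.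
  exact: leqW.
by rewrite PSm size_cat ltn_add2l size_mkseq leqW.
Qed.
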